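(* Let $\theta\in\mathbb{R}$ and let $$g=\begin{pmatrix} e^{\mathbf i\theta} & 0\\ 0 & e^{-\mathbf i\theta}\end{pmatrix},\qquad h=\begin{pmatrix} a & b\\ c & d\end{pmatrix}\in SL(2,\mathbb{C}).$$ If $\langle g,h\rangle$ is discrete and non-elementary, then $$\inf_{t\in\mathbb{C},\ |t|<1} 4f(t)\sin^2\theta\ \ge 1,$$ where $$f(t)=\frac{|1-t^2|^2(|a|^2+|d|^2)+|1+t|^4|c|^2+|1-t|^4|b|^2+2(\bar t-t)^2}{4(1-|t|^2)^2}+\frac12 .$$
   Context: $SL(2,\mathbb{C})$ acts as the group of (orientation preserving) isometries of hyperbolic $3$-space / Möbius transformations; a subgroup is non-elementary in the usual sense of Kleinian groups. Here $\mathbf i=\sqrt{-1}$. *)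

(* Defs.v *)
From HB Require Import structures.
From mathcomp Require Import all_boot all_order all_algebra.
From mathcomp Require Import complex.
From mathcomp Require Import reals trigo.

Set Implicit Arguments.
Unset Strict Implicit.
Unset Printing Implicit Defensive.

Import Order.TTheory GRing.Theory Num.Theory.
Local Open Scope ring_scope.
Local Open Scope complex_scope.

Section Defs.
Variable R : realType.
Local Notation C := R[i].
Local Notation M := 'M[C]_2.

Definition cabs (z : C) : R := ComplexField.Normc.normc z.

Definition SL2 (A : M) : Prop := \det A = 1.

Definition adjoint (A : M) : M := \matrix_(i < 2, j < 2) (A j i)^*.

Inductive gen2 (g h : M) : M -> Prop :=
| gen2_1 : gen2 g h 1
| gen2_g x : gen2 g h x -> gen2 g h (x *m g)
| gen2_gV x : gen2 g h x -> gen2 g h (x *m invmx g)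
| gen2_h x : gen2 g h x -> gen2 g h (x *m h)
| gen2_hV x : gen2 g h x -> gen2 g h (x *m invmx h).

(* a norm on M_2(C) = C^4 (all norms induce the same topology) *)
Definition mxnorm (A : M) : R := \sum_(i < 2) \sum_(j < 2) cabs (A i j).

Definition discrete_set (G : M -> Prop) : Prop :=
  forall x, G x -> exists2 e : R, 0 < e &
    forall y, G y -> mxnorm (y - x) < e -> y = x.

(* Hyperbolic 3-space, model: positive definite Hermitian matrices of
   determinant 1 (= SL(2,C)/SU(2)), with action X |-> A X A^* *)
Definition H3point (X : M) : Prop :=
  adjoint X = X /\ 0 < X 0 0 /\ \det X = 1.

Definition H3act (A X : M) : M := A *m X *m adjoint A.

(* Riemann sphere = CP^1 (lines in C^2), with action [v] |-> [A v].
   A finite orbit on the sphere: a nonzero v such that the lines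
   C (A v), A in G, are finitely many. *)
Definition finite_orbit_sphere (G : M -> Prop) : Prop :=
  exists2 v : 'cV[C]_2, v != 0 &
    exists s : seq 'cV[C]_2, forall A, G A ->
      exists2 w, w \in s & exists lam : C, A *m v = lam *: w.

Definition finite_orbit_H3 (G : M -> Prop) : Prop :=
  exists2 X : M, H3point X &
    exists s : seq M, forall A, G A -> H3act A X \in s.

(* Kleinian-group sense: elementary iff it has a finite orbit in
   H^3 \cup \partial H^3 *)
Definition elementary (G : M -> Prop) : Prop :=
  finite_orbit_sphere G \/ finite_orbit_H3 G.

Definition non_elementary (G : M -> Prop) : Prop := ~ elementary G.

Definition expi (theta : R) : C := (cos theta) +i* (sin theta).
Definition rotmx (theta : R) : M :=
  \matrix_(i < 2, j < 2)
    (if i == j then (if i == 0 then expi theta else expi (- theta)) else 0).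

Definition mx2 (a b c d : C) : M :=
  \matrix_(i < 2, j < 2)
    (if i == 0 then (if j == 0 then a else b) else (if j == 0 then c else d)).

(* f(t); the term (conj t - t)^2 is real, we take its real part *)
Definition ff (a b c d t : C) : R :=
  (cabs (1 - t ^+ 2) ^+ 2 * (cabs a ^+ 2 + cabs d ^+ 2)
   + cabs (1 + t) ^+ 4 * cabs c ^+ 2
   + cabs (1 - t) ^+ 4 * cabs b ^+ 2
   + 2 * complex.Re ((t^* - t) ^+ 2))
  / (4 * (1 - cabs t ^+ 2) ^+ 2) + 1 / 2.

End Defs.

(* Main.v *)
Require Import Defs.
From HB Require Import structures.
From mathcomp Require Import all_boot all_order all_algebra.
From mathcomp Require Import complex.
From mathcomp Require Import reals trigo.
From mathcomp Require Import ring lra.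
Import Order.TTheory GRing.Theory Num.Theory.
Local Open Scope ring_scope.
Local Open Scope complex_scope.

(** Let N(X) = |a|^2 + |d|^2 + q |c|^2 + |b|^2 / q with q = |1+t|^2 / |1-t|^2.
    Then 4 f(t) >= N(h) + 2, so if the inequality fails,
    K = sin^2(theta) (N(h) + 2) < 1.  (N(h) = 2 cosh rho, where rho is the
    displacement by h of a point on the axis of g.)  As in the
    Shimizu-Leutbecher-Jorgensen argument put h_0 = h and
    h_(n+1) = h_n g h_n^-1.  The inequality
      N(h_(n+1)) - 2 <= sin^2(theta) (N(h_n) + 2) (N(h_n) - 2)
    makes N(h_n) - 2 tend to 0 geometrically, and then the off-diagonal part
    M of N tends to 0 as well, since
      M(h_(n+1)) <= 4 sin^2(theta) M(h_n) + (N(h_(n+1)) - 2).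
    Hence h_n tends to g, so h_n = g for large n by discreteness.  But if h is
    neither diagonal nor antidiagonal, i.e. (ab, cd) <> (0, 0), then the same
    holds for every h_n; and if h is one of these, or sin(theta) = 0, the
    group is elementary. *)

(** * Squared moduli and Cauchy-Schwarz type bounds *)

(** Unlike [cabs], this is a polynomial in the coordinates, so [ring] and [lra] can work with it. *)
Definition normsq {R : realType} (z : R[i]) : R :=
  complex.Re z ^+ 2 + complex.Im z ^+ 2.

Section Normsq.
Variable R : realType.
Implicit Types (z w : R[i]) (k : R).

Lemma normsq_ge0 z : 0 <= normsq z.
Proof. by rewrite addr_ge0 ?sqr_ge0. Qed.

Lemma cabs_sqr z : cabs z ^+ 2 = normsq z.
Proof. by case: z => x y; rewrite /cabs /= sqr_sqrtr // addr_ge0 ?sqr_ge0. Qed.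

Lemma cabs_ge0 z : 0 <= cabs z.
Proof. by case: z => x y; rewrite /cabs /= sqrtr_ge0. Qed.

Lemma cabs_lt z k : 0 < k -> normsq z < k ^+ 2 -> cabs z < k.
Proof. by move=> k0; rewrite -cabs_sqr ltr_sqr // nnegrE ?cabs_ge0 ?ltW. Qed.

Lemma normsqM z w : normsq (z * w) = normsq z * normsq w.
Proof. by case: z w => [x y] [x' y']; rewrite /normsq /=; ring. Qed.

Lemma normsqN z : normsq (- z) = normsq z.
Proof. by case: z => x y; rewrite /normsq /=; ring. Qed.

Lemma normsq_1D z : normsq (1 + z) = 1 + 2 * complex.Re z + normsq z.
Proof. by case: z => x y; rewrite /normsq /=; ring. Qed.

Lemma Re_mul_le z w : 2 * complex.Re (z * w) <= normsq z + normsq w.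
Proof.
case: z w => [x y] [x' y']; rewrite /normsq /= -subr_ge0.
have -> : x ^+ 2 + y ^+ 2 + (x' ^+ 2 + y' ^+ 2) - 2 * (x * x' - y * y') =
  (x - x') ^+ 2 + (y + y') ^+ 2 by ring.
by rewrite addr_ge0 ?sqr_ge0.
Qed.

Lemma Re_mul_ge_weighted k z w : 0 < k ->
  - (2 * complex.Re (z * w)) <= normsq z / k + k * normsq w.
Proof.
case: z w => [x y] [x' y'] k0; rewrite /normsq /= -subr_ge0.
have -> : (x ^+ 2 + y ^+ 2) / k + k * (x' ^+ 2 + y' ^+ 2) -
  - (2 * (x * x' - y * y')) = k * ((x / k + x') ^+ 2 + (y / k - y') ^+ 2).
  by field; rewrite gt_eqF.
by rewrite mulr_ge0 ?(ltW k0) // addr_ge0 ?sqr_ge0.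
Qed.

End Normsq.

(** * Explicit 2x2 matrices and conjugates of the rotation *)

Lemma ord2_cases (i : 'I_2) : i = 0 \/ i = 1.
Proof. by case: i => [[|[|//]]] ?; [left|right]; apply: val_inj. Qed.

Section TwoByTwo.
Variable R : realType.
Implicit Types (a b c d : R[i]) (theta : R).

Lemma mx2_ext (A B : 'M[R[i]]_2) :
  A 0 0 = B 0 0 -> A 0 1 = B 0 1 -> A 1 0 = B 1 0 -> A 1 1 = B 1 1 -> A = B.
Proof.
move=> e00 e01 e10 e11; apply/matrixP => i j.
by have [->|->] := ord2_cases i; have [->|->] := ord2_cases j.
Qed.

Lemma mx2_mul a b c d a' b' c' d' :
  mx2 a b c d *m mx2 a' b' c' d' =
  mx2 (a * a' + b * c') (a * b' + b * d') (c * a' + d * c') (c * b' + d * d').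
Proof. by apply: mx2_ext; rewrite !mxE !big_ord_recr big_ord0 /= !mxE /= add0r. Qed.

Lemma mx2_1 : mx2 1 0 0 1 = 1 :> 'M[R[i]]_2.
Proof. by apply: mx2_ext; rewrite !mxE. Qed.

Lemma det_mx2E a b c d : \det (mx2 a b c d) = a * d - b * c.
Proof.
by rewrite (expand_det_row _ 0) !big_ord_recr big_ord0 /= /cofactor !det_mx11 !mxE /=;
   rewrite /bump /=; ring.
Qed.

Lemma mx2_unit a b c d : a * d - b * c = 1 -> mx2 a b c d \in unitmx.
Proof. by move=> h; rewrite unitmxE det_mx2E h unitr1. Qed.

Lemma mx2_inv a b c d : a * d - b * c = 1 ->
  invmx (mx2 a b c d) = mx2 d (- b) (- c) a.
Proof.
move=> h; apply: (can_inj (mulKmx (mx2_unit _ _ _ _ h))).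
rewrite mulmxV ?mx2_unit // mx2_mul -[1%:M]mx2_1 -h.
by congr mx2; ring.
Qed.

Lemma rotmxE theta :
  rotmx theta = mx2 (expi theta) 0 0 (expi (- theta)).
Proof. by apply: mx2_ext; rewrite !mxE. Qed.

Lemma expiM_N theta : expi theta * expi (- theta) = 1.
Proof.
rewrite /expi cosN sinN; apply/eqP; rewrite eq_complex /=; apply/andP; split.
  by rewrite mulrN opprK -!expr2 cos2Dsin2.
by apply/eqP; ring.
Qed.

Lemma normsq_expiB theta :
  normsq (expi theta - expi (- theta)) = 4 * sin theta ^+ 2.
Proof. by rewrite /normsq /= cosN sinN; ring. Qed.

Lemma rotmx_det theta : expi theta * expi (- theta) - 0 * 0 = 1.
Proof. by rewrite mulr0 subr0 expiM_N. Qed.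

(** [rotmx theta] is [expi (- theta)] times the identity plus [k] times the matrix unit at (0,0).
    Its conjugate is therefore the same scalar plus [k] times the column (a, c) times the row (d,
    -b). *)
Lemma conj_rotmx a b c d theta (k := expi theta - expi (- theta)) :
  a * d - b * c = 1 ->
  mx2 a b c d *m rotmx theta *m invmx (mx2 a b c d) =
  mx2 (expi theta + k * (b * c)) (- (k * (a * b)))
      (k * (c * d)) (expi (- theta) - k * (b * c)).
Proof.
move=> h; rewrite (mx2_inv _ _ _ _ h) rotmxE !mx2_mul.
have ad : a * d = 1 + b * c by rewrite -h; ring.
congr mx2; rewrite /k; last 1 first.
- rewrite (_ : _ + _ = expi (- theta) * (a * d) - expi theta * (b * c)); last by ring.
  by rewrite ad; ring.
- rewrite (_ : _ + _ = expi theta * (a * d) - expi (- theta) * (b * c)); last by ring.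
  by rewrite ad; ring.
- by ring.
- by ring.
Qed.

End TwoByTwo.

(** * The generated group, and finite invariant sets of lines *)

Section Generated.
Variables (R : realType) (g h : 'M[R[i]]_2).
Hypotheses (gu : g \in unitmx) (hu : h \in unitmx).

Lemma gen2M x y : gen2 g h x -> gen2 g h y -> gen2 g h (x *m y).
Proof.
move=> Gx; elim=> [|z _ IH|z _ IH|z _ IH|z _ IH]; rewrite ?mulmxA.
- by rewrite mulmx1.
- exact: gen2_g.
- exact: gen2_gV.
- exact: gen2_h.
- exact: gen2_hV.
Qed.

Lemma gen2_self : gen2 g h g.
Proof. by rewrite -[g in X in gen2 _ _ X]mul1mx; apply/gen2_g/gen2_1. Qed.

Lemma gen2_self_h : gen2 g h h.
Proof. by rewrite -[h in X in gen2 _ _ X]mul1mx; apply/gen2_h/gen2_1. Qed.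

(** Inversion reverses a word, so the last letter becomes a left factor, which [gen2M] handles. *)
Lemma gen2V x : gen2 g h x -> x \in unitmx /\ gen2 g h (invmx x).
Proof.
have one := gen2_1 g h.
elim=> [|z _ [zu IH]|z _ [zu IH]|z _ [zu IH]|z _ [zu IH]].
- by rewrite invmx1 unitmx1.
- split; first by rewrite unitmx_mul zu.
  rewrite [invmx _](_ : _ = invmx g *m invmx z); last exact: invrM.
  by apply: gen2M => //; rewrite -[invmx g]mul1mx; apply: gen2_gV.
- split; first by rewrite unitmx_mul zu unitmx_inv.
  rewrite [invmx _](_ : _ = invmx (invmx g) *m invmx z); last by apply: invrM; rewrite ?unitrV.
  by apply: gen2M => //; rewrite invmxK; exact: gen2_self.
- split; first by rewrite unitmx_mul zu.
  rewrite [invmx _](_ : _ = invmx h *m invmx z); last exact: invrM.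
  by apply: gen2M => //; rewrite -[invmx h]mul1mx; apply: gen2_hV.
- split; first by rewrite unitmx_mul zu unitmx_inv.
  rewrite [invmx _](_ : _ = invmx (invmx h) *m invmx z); last by apply: invrM; rewrite ?unitrV.
  by apply: gen2M => //; rewrite invmxK; exact: gen2_self_h.
Qed.

Lemma invariant_lines_elementary (v : 'cV[R[i]]_2) (s : seq 'cV[R[i]]_2) :
  v != 0 -> v \in s ->
  (forall k, k \in [:: g; invmx g; h; invmx h] -> forall w, w \in s ->
     exists2 w', w' \in s & exists lam : R[i], k *m w = lam *: w') ->
  elementary (gen2 g h).
Proof.
move=> v0 vs H; left; exists v => //; exists s => A GA.
(* Words grow on the right, so the last letter acts first and moves [v]; the induction hypothesis
   must cover every line in [s]. *)
elim: GA {v0} v vs => [|z _ IH|z _ IH|z _ IH|z _ IH] v vs.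
  by exists v => //; exists 1; rewrite mul1mx scale1r.
all: [> have [|w ws [lam e]] := H g _ v vs | have [|w ws [lam e]] := H (invmx g) _ v vs
      | have [|w ws [lam e]] := H h _ v vs | have [|w ws [lam e]] := H (invmx h) _ v vs].
all: rewrite ?inE ?eqxx ?orbT //.
all: have [w' w's [lam' e']] := IH w ws; exists w' => //; exists (lam * lam').
all: by rewrite -mulmxA e -scalemxAr e' scalerA.
Qed.

End Generated.

(** The characteristic polynomial has a root because [R[i]] is algebraically closed. The transposes
    are there because [eigenvalue] refers to row vectors. *)
Lemma mx2_eigenvector (R : realType) (A : 'M[R[i]]_2) :
  exists2 v : 'cV[R[i]]_2, v != 0 & exists lam : R[i], A *m v = lam *: v.
Proof.
have /closed_rootP[lam] : size (char_poly A^T) != 1%N by rewrite size_char_poly.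
rewrite -eigenvalue_root_char => /eigenvalueP[v e v0].
exists v^T; first by rewrite trmx_eq0.
by exists lam; apply: trmx_inj; rewrite trmx_mul trmxK e linearZ /= trmxK.
Qed.

(* [wnorm q] is the squared Frobenius norm of D^-1 X D, where
   D = diag(q^(1/4), q^(-1/4)). *)
Definition offdiag {R : realType} (q : R) (b c : R[i]) : R :=
  q * normsq c + normsq b / q.

Definition wnorm {R : realType} (q : R) (a b c d : R[i]) : R :=
  normsq a + normsq d + offdiag q b c.

(** * The weighted norm under one conjugation step *)

Section Descent.
Variables (R : realType) (q theta : R).
Hypothesis q0 : 0 < q.
Implicit Types a b c d : R[i].
Local Notation s := (sin theta ^+ 2).
Local Notation k := (expi theta - expi (- theta)).

Lemma offdiag_ge0 b c : 0 <= offdiag q b c.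
Proof. by rewrite addr_ge0 ?mulr_ge0 ?invr_ge0 ?normsq_ge0 ?(ltW q0). Qed.

Lemma offdiag_Re b c : - (2 * complex.Re (b * c)) <= offdiag q b c.
Proof. by rewrite /offdiag addrC; apply: Re_mul_ge_weighted. Qed.

(** The diagonal part is at least 2 Re(ad) and the off-diagonal part at least -2 Re(bc); the sum of
    these bounds is twice the determinant. *)
Lemma wnorm_ge2 a b c d : a * d - b * c = 1 -> 2 <= wnorm q a b c d.
Proof.
move=> h; have := offdiag_Re b c; have := Re_mul_le _ a d.
have -> : a * d = 1 + b * c by rewrite -h; ring.
by rewrite /wnorm raddfD /=; lra.
Qed.

Lemma normsq_diag_conj z :
  normsq (expi theta + k * z) + normsq (expi (- theta) - k * z) =
  2 + 8 * s * (normsq z + complex.Re z).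
Proof.
case: z => x y; rewrite /normsq /= cosN sinN.
rewrite [RHS](_ : _ = 2 * (cos theta ^+ 2 + s) + 8 * s * (x ^+ 2 + y ^+ 2 + x)).
  by ring.
by rewrite cos2Dsin2; ring.
Qed.

Lemma offdiag_conj a b c d :
  offdiag q (- (k * (a * b))) (k * (c * d)) =
  4 * s * (normsq a * (normsq b / q) + q * normsq c * normsq d).
Proof.
by rewrite /offdiag normsqN !normsqM normsq_expiB; field; rewrite gt_eqF.
Qed.

Section Step.
Variables a b c d : R[i].
Hypothesis h : a * d - b * c = 1.
Let M0 := offdiag q b c.
Let N0 := wnorm q a b c d.
Let M1 := offdiag q (- (k * (a * b))) (k * (c * d)).
Let N1 := wnorm q (expi theta + k * (b * c)) (- (k * (a * b)))
                  (k * (c * d)) (expi (- theta) - k * (b * c)).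

Let bcE : normsq (b * c) = normsq b / q * (q * normsq c).
Proof. by rewrite normsqM; field; rewrite gt_eqF. Qed.

Let adE :
  normsq a * normsq d = 1 + 2 * complex.Re (b * c) + normsq (b * c).
Proof. by rewrite -normsqM -normsq_1D; congr normsq; rewrite -h; ring. Qed.

Lemma wnorm_conj_offdiag :
  N1 - 2 = M1 + 8 * s * (normsq (b * c) + complex.Re (b * c)).
Proof. by rewrite /N1 /M1 /wnorm normsq_diag_conj; ring. Qed.

(* N1 - 2 = 4 s (p p' - 1), where p and p' are the weighted squared norms of
   the columns of the matrix, whose sum is N0. *)
Lemma wnorm_conj : N1 - 2 <= s * (N0 + 2) * (N0 - 2).
Proof.
rewrite wnorm_conj_offdiag /M1 offdiag_conj.
set p := normsq a + q * normsq c; set p' := normsq b / q + normsq d.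
have -> : 4 * s * (normsq a * (normsq b / q) + q * normsq c * normsq d) +
   8 * s * (normsq (b * c) + complex.Re (b * c)) = s * (4 * (p * p' - 1)).
  have -> : p * p' = normsq a * (normsq b / q) + q * normsq c * normsq d +
     normsq a * normsq d + normsq b / q * (q * normsq c) by rewrite /p /p'; ring.
  by rewrite adE -bcE; ring.
have -> : N0 = p + p' by rewrite /N0 /wnorm /offdiag /p /p'; ring.
(* What remains is 4(pp' - 1) <= (p + p')^2 - 4, whose gap is (p - p')^2. *)
rewrite -mulrA ler_wpM2l ?sqr_ge0 // -subr_ge0.
by rewrite [X in 0 <= X](_ : _ = (p - p') ^+ 2) ?sqr_ge0 //; ring.
Qed.

(** In [wnorm_conj_offdiag] only the term 8 s Re(bc) can be negative, and by [offdiag_Re] it is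
    absorbed by 4 s M0. *)
Lemma offdiag_conj_le : M1 <= 4 * s * M0 + (N1 - 2).
Proof.
rewrite wnorm_conj_offdiag -subr_ge0.
have -> : 4 * s * M0 + (M1 + 8 * s * (normsq (b * c) + complex.Re (b * c))) - M1
  = 4 * s * (M0 + 2 * complex.Re (b * c) + 2 * normsq (b * c)) by ring.
apply: mulr_ge0; first by rewrite mulr_ge0 ?sqr_ge0.
have := offdiag_Re b c; have := normsq_ge0 _ (b * c).
rewrite -/M0; lra.
Qed.

(** N - 2 contracts by K, but M contracts only up to the error N1 - 2, so the two are combined with
    a weight. The rate [kap] is the midpoint of K and 1, and [lam] solves (1 + lam) K = kap lam. *)
Lemma lyapunov_conj (K : R) (kap := (1 + K) / 2) (lam := 2 * K / (1 - K)) :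
  s * (N0 + 2) <= K -> K < 1 ->
  s * (N1 + 2) <= K /\ M1 + lam * (N1 - 2) <= kap * (M0 + lam * (N0 - 2)).
Proof.
move=> sK K1.
have N02 : 0 <= N0 - 2 by rewrite subr_ge0; exact: wnorm_ge2.
have s0 : 0 <= s by exact: sqr_ge0.
have N1K : N1 - 2 <= K * (N0 - 2).
  by apply: le_trans wnorm_conj _; rewrite ler_wpM2r.
have M00 : 0 <= M0 := offdiag_ge0 b c.
have s4 : 4 * s <= K.
  apply: le_trans sK; rewrite [leRHS](_ : _ = 4 * s + s * (N0 - 2)); last by ring.
  by rewrite lerDl mulr_ge0.
have K0 : 0 <= K by apply: le_trans s4; rewrite mulr_ge0.
have le1 : K * (N0 - 2) <= N0 - 2 by rewrite ler_piMl // ltW.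
split.
  by apply: le_trans sK; rewrite ler_wpM2l //; lra.
have lam0 : 0 <= lam by rewrite /lam divr_ge0 ?mulr_ge0 // subr_ge0 ltW.
have lamE : (1 + lam) * K = kap * lam.
  by rewrite /lam /kap; field; rewrite subr_eq0 gt_eqF.
have e1 : (1 + lam) * (N1 - 2) <= kap * lam * (N0 - 2).
  by rewrite -lamE -mulrA ler_wpM2l // addr_ge0.
have e2 : 4 * s * M0 <= kap * M0.
  by apply: ler_wpM2r => //; apply: le_trans s4 _; rewrite /kap; lra.
by have := offdiag_conj_le; lra.
Qed.

End Step.
End Descent.

(** * Convergence to the rotation, against discreteness *)

(** The Bernoulli-type bound x^n <= 1 / (1 + n(1 - x)) reduces this to the archimedean property. *)
Lemma geometric_small (R : realType) (x L eta : R) :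
  0 <= x < 1 -> 0 <= L -> 0 < eta -> exists n : nat, x ^+ n * L < eta.
Proof.
move=> /andP[x0 x1] L0 eta0; have y0 : 0 < 1 - x by rewrite subr_gt0.
have bernoulli n : x ^+ n * (1 + n%:R * (1 - x)) <= 1.
  elim: n => [|n IH]; first by rewrite expr0 mul0r addr0 mulr1.
  apply: le_trans IH; rewrite exprSr -mulrA ler_wpM2l ?exprn_ge0 //.
  rewrite -subr_ge0 mulrS [X in 0 <= X](_ : _ = (n%:R + 1) * (1 - x) ^+ 2).
    by rewrite mulr_ge0 ?sqr_ge0 // addr_ge0.
  by ring.
have ye0 : 0 < eta * (1 - x) by rewrite mulr_gt0.
set n := Num.bound (L / (eta * (1 - x))); exists n.
have : L / (eta * (1 - x)) < n%:R by apply: archi_boundP; rewrite divr_ge0 // ltW.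
rewrite ltr_pdivrMr // => Ln.
have n0 : 0 < 1 + n%:R * (1 - x) by rewrite ltr_pwDl // mulr_ge0 // ltW.
rewrite -(ltr_pM2r n0); apply: (@le_lt_trans _ _ L).
  rewrite mulrAC -[leRHS]mul1r; exact: ler_wpM2r.
by apply: lt_le_trans Ln _; rewrite mulrCA ler_wpM2l ?(ltW eta0) // lerDr.
Qed.

Section Convergence.
Variables (R : realType) (theta : R).
Implicit Types a b c d : R[i].
Local Notation s := (sin theta ^+ 2).
Local Notation k := (expi theta - expi (- theta)).

Lemma conj_rotmx_det a b c d : a * d - b * c = 1 ->
  (expi theta + k * (b * c)) * (expi (- theta) - k * (b * c)) -
  - (k * (a * b)) * (k * (c * d)) = 1.
Proof.
move=> h; have ad : a * d = 1 + b * c by rewrite -h; ring.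
rewrite -(expiM_N R theta).
have -> : - (k * (a * b)) * (k * (c * d)) = - (k ^+ 2 * (a * d) * (b * c)) by ring.
by rewrite ad; ring.
Qed.

Lemma expiB_neq0 : sin theta != 0 -> k != 0.
Proof.
apply: contraNneq => k0; have := normsq_expiB R theta.
rewrite k0 /normsq /= expr0n /= addr0 => /esym/eqP.
by rewrite mulf_eq0 pnatr_eq0 /= sqrf_eq0.
Qed.

(** The conjugate is not diagonal since [k], and one of [a * b] and [c * d], are nonzero. It is not
    antidiagonal since its trace 2 cos(theta) is nonzero. With determinant 1, this leaves one of the
    two products nonzero. *)
Lemma generic_conj a b c d :
  sin theta != 0 -> cos theta != 0 -> a * d - b * c = 1 ->
  (a * b != 0) || (c * d != 0) ->
  ((expi theta + k * (b * c)) * - (k * (a * b)) != 0) ||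
  (k * (c * d) * (expi (- theta) - k * (b * c)) != 0).
Proof.
move=> /expiB_neq0 k0 c0 h gen.
have : (- (k * (a * b)) != 0) || (k * (c * d) != 0).
  by rewrite oppr_eq0 !(mulf_eq0 k) (negPf k0).
have tr : expi theta + k * (b * c) + (expi (- theta) - k * (b * c)) != 0.
  apply: contraNneq c0 => e; have : expi theta + expi (- theta) = 0.
    by rewrite -e; ring.
  by move=> /(congr1 (@complex.Re R)) /=; rewrite cosN => e0; apply/eqP; lra.
move: tr (conj_rotmx_det _ _ _ _ h).
move: (expi theta + k * (b * c)) (expi (- theta) - k * (b * c)).
move: (- (k * (a * b))) (k * (c * d)) => b1 c1 a1 d1.
rewrite !mulf_eq0 !negb_or; have [->|] := eqVneq a1 0; last first.
  have [->|] := eqVneq d1 0; last by rewrite andbT.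
  have [->|] := eqVneq b1 0; last by [].
  by rewrite mulr0 mul0r subr0 => _ _ /esym/eqP; rewrite oner_eq0.
rewrite add0r mul0r sub0r => -> /=; rewrite andbT.
have [->|//] := eqVneq c1 0.
by rewrite mulr0 oppr0 => /esym/eqP; rewrite oner_eq0.
Qed.

Lemma mxnorm_lt (A : 'M[R[i]]_2) (r : R) : 0 < r ->
  (forall i j, normsq (A i j) < (r / 4) ^+ 2) -> mxnorm A < r.
Proof.
move=> r0 H; have r4 : 0 < r / 4 by lra.
have lt i j : cabs (A i j) < r / 4 by apply: cabs_lt.
rewrite /mxnorm !big_ord_recr !big_ord0 /= !add0r.
have := lt 0 0; have := lt 0 1; have := lt 1 0; have := lt 1 1.
set i1 := widen_ord _ _; set i2 := ord_max.
have -> : i1 = 0 by apply: val_inj.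
have -> : i2 = 1 by apply: val_inj.
by lra.
Qed.

Lemma conj_near_rotmx (q e : R) : 0 < q -> 0 < e ->
  4 * s <= 1 -> exists2 eta, 0 < eta & forall a b c d,
  a * d - b * c = 1 -> offdiag q b c < eta ->
  offdiag q (- (k * (a * b))) (k * (c * d)) < eta ->
  mxnorm (mx2 a b c d *m rotmx theta *m invmx (mx2 a b c d) - rotmx theta) < e.
Proof.
move=> q0 e0 s1; set r := (e / 4) ^+ 2.
have r0 : 0 < r by rewrite exprn_gt0 // divr_gt0.
(* The bounds 1 and r control the diagonal error, as |k b c|^2 is at most the product of the two
   terms of [offdiag q b c]. The bounds q r and r / q control the lower left and upper right entries
   of the conjugate. *)
exists (Num.min (Num.min 1 r) (Num.min (q * r) (r / q))).
  by rewrite !lt_min ltr01 r0 mulr_gt0 // divr_gt0.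
move=> a b c d h; rewrite !lt_min.
move=> /andP[/andP[M1 Mr] _] /andP[_ /andP[]].
rewrite conj_rotmx // rotmxE.
move: (k * (a * b)) (k * (c * d)) => b1 c1 Mb Mc.
have n0 := @normsq_ge0 R.
have wpos x y : 0 <= q * normsq x /\ 0 <= normsq y / q.
  by rewrite divr_ge0 ?mulr_ge0 ?(ltW q0).
have diag : normsq (k * (b * c)) < r.
  rewrite normsqM normsq_expiB normsqM.
  have -> : normsq b * normsq c = (normsq b / q) * (q * normsq c).
    by field; rewrite gt_eqF.
  have [w1 w2] := wpos c b; move: M1 Mr w1 w2; rewrite /offdiag.
  move: (q * _) (_ / q) => x y x1 xr x0 y0.
  apply: (@le_lt_trans _ _ (1 * (y * 1))); last by lra.
  have s40 : 0 <= 4 * s by rewrite mulr_ge0 ?sqr_ge0.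
  apply: ler_pM => //; first exact: mulr_ge0.
  by apply: ler_wpM2l => //; lra.
have offb : normsq b1 < r.
  have [w1 _] := wpos c1 (- b1).
  rewrite -(ltr_pM2r (_ : 0 < q^-1)) ?invr_gt0 //.
  by move: Mc w1; rewrite /offdiag normsqN; lra.
have offc : normsq c1 < r.
  have [_ w2] := wpos c1 (- b1).
  rewrite -(ltr_pM2l q0).
  by move: Mb w2; rewrite /offdiag; lra.
apply: mxnorm_lt => // i j; rewrite -/r.
have [->|->] := ord2_cases i; have [->|->] := ord2_cases j; rewrite !mxE /=.
- by rewrite addrAC subrr add0r.
- by rewrite subr0 normsqN.
- by rewrite subr0.
- by rewrite addrAC subrr add0r normsqN.
Qed.

(** The sequence h_n is given only through the invariants that pass from one term to the next; L is
    the value of the Lyapunov quantity at h. *)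
Lemma gen2_descent (q K : R) a b c d (G := gen2 (rotmx theta) (mx2 a b c d)) :
  0 < q -> sin theta != 0 -> cos theta != 0 -> a * d - b * c = 1 ->
  (a * b != 0) || (c * d != 0) -> s * (wnorm q a b c d + 2) <= K -> K < 1 ->
  exists L, 0 <= L /\ forall n, exists a' b' c' d',
    [/\ G (mx2 a' b' c' d'), a' * d' - b' * c' = 1,
        (a' * b' != 0) || (c' * d' != 0), s * (wnorm q a' b' c' d' + 2) <= K &
        offdiag q b' c' + 2 * K / (1 - K) * (wnorm q a' b' c' d' - 2)
          <= ((1 + K) / 2) ^+ n * L].
Proof.
move=> q0 s0 c0 h gen sK K1.
have K0 : 0 <= K.
  apply: le_trans sK; rewrite mulr_ge0 ?sqr_ge0 //.
  by have := @wnorm_ge2 _ _ q0 _ _ _ _ h; lra.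
have u1 : rotmx theta \in unitmx by rewrite rotmxE mx2_unit // rotmx_det.
have u2 : mx2 a b c d \in unitmx by rewrite mx2_unit.
have lam0 : 0 <= 2 * K / (1 - K) by rewrite divr_ge0 ?mulr_ge0 // subr_ge0 ltW.
exists (offdiag q b c + 2 * K / (1 - K) * (wnorm q a b c d - 2)); split.
  by rewrite addr_ge0 ?offdiag_ge0 // mulr_ge0 // subr_ge0 wnorm_ge2.
elim=> [|n [a' [b' [c' [d' [Gx h' gen' sK' le]]]]]].
  by exists a, b, c, d; rewrite expr0 mul1r; split => //; exact: gen2_self_h.
exists (expi theta + k * (b' * c')), (- (k * (a' * b'))), (k * (c' * d')),
  (expi (- theta) - k * (b' * c')).
have [sK1 le1] := @lyapunov_conj _ q theta q0 _ _ _ _ h' _ sK' K1.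
split => //; [|exact: conj_rotmx_det|exact: generic_conj|].
  rewrite -conj_rotmx //; apply: gen2M; last by apply: (gen2V _ _ _ u1 u2 _ Gx).2.
  exact: gen2_g.
apply: le_trans le1 _; rewrite exprS -[leRHS]mulrA ler_wpM2l //.
by rewrite divr_ge0 // addr_ge0.
Qed.

(** Each q > 0 corresponds to a point of the axis of g, so this bounds from below the displacement
    by h of every such point. *)
Lemma discrete_generic_wnorm (q : R) a b c d : 0 < q -> sin theta != 0 ->
  a * d - b * c = 1 -> (a * b != 0) || (c * d != 0) ->
  discrete_set (gen2 (rotmx theta) (mx2 a b c d)) ->
  1 <= s * (wnorm q a b c d + 2).
Proof.
move=> q0 s0 h gen disc; rewrite leNgt; apply/negP => K1.
have N2 := @wnorm_ge2 _ _ q0 _ _ _ _ h.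
have s41 : 4 * s < 1.
  apply: le_lt_trans K1; rewrite mulrC ler_wpM2l ?sqr_ge0 //.
  by move: N2; lra.
(* If cos(theta) vanished, then s = 1, against 4 s < 1. *)
have c0 : cos theta != 0.
  apply/eqP => c0; have := cos2Dsin2 theta; rewrite c0 expr0n /= add0r => s1.
  by move: s41; rewrite s1; lra.
have [L [L0 desc]] := gen2_descent _ _ _ _ _ _ q0 s0 c0 h gen (lexx _) K1.
set K := s * _ in K1 desc.
have [e e0 isol] := disc _ (gen2_self _ (rotmx theta) (mx2 a b c d)).
have [eta eta0 near] := conj_near_rotmx _ _ q0 e0 (ltW s41).
have K0 : 0 <= K by rewrite mulr_ge0 ?sqr_ge0 // addr_ge0 // (le_trans _ N2).
clearbody K.
have kap : 0 <= (1 + K) / 2 < 1 by apply/andP; split; lra.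
have [n small] := geometric_small _ _ _ _ kap L0 eta0.
have [a' [b' [c' [d' [Gx h' gen' sK' le]]]]] := desc n.
have lam0 : 0 <= 2 * K / (1 - K) by rewrite divr_ge0 ?mulr_ge0 // subr_ge0 ltW.
(* [conj_near_rotmx] needs a small off-diagonal part both for h_n and for its successor. *)
have [_ le1] := @lyapunov_conj _ q theta q0 _ _ _ _ h' _ sK' K1.
have drop_wnorm x y z w M : x * w - y * z = 1 ->
    offdiag q y z + 2 * K / (1 - K) * (wnorm q x y z w - 2) <= M ->
    offdiag q y z <= M.
  by move=> hx; apply: le_trans; rewrite lerDl mulr_ge0 // subr_ge0 wnorm_ge2.
have close : mxnorm (mx2 a' b' c' d' *m rotmx theta *m invmx (mx2 a' b' c' d')
                     - rotmx theta) < e.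
  apply: near => //; first exact: le_lt_trans (drop_wnorm _ _ _ _ _ h' le) small.
  apply: le_lt_trans (drop_wnorm _ _ _ _ _ (conj_rotmx_det _ _ _ _ h') le1) _.
  case/andP: kap => kap0 kap1; apply: le_lt_trans (_ : _ <= _) small.
  apply: le_trans (ler_wpM2l kap0 le) _.
  by apply: ler_piMl; [rewrite mulr_ge0 ?exprn_ge0 | exact: ltW].
have u1 : rotmx theta \in unitmx by rewrite rotmxE mx2_unit // rotmx_det.
have u2 : mx2 a b c d \in unitmx by rewrite mx2_unit.
(* Isolation of g forces h_n g h_n^-1 = g, so the entries -k a'b' and k c'd' vanish, against
   genericity of h_n. *)
have := isol _ (gen2M _ _ _ _ _ (gen2_g Gx) (gen2V _ _ _ u1 u2 _ Gx).2) close.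
rewrite conj_rotmx // rotmxE => /matrixP eg.
have := eg 0 1; have := eg 1 0; rewrite !mxE /= => /eqP + /eqP.
rewrite oppr_eq0 !(mulf_eq0 k) (negPf (expiB_neq0 s0)) /=.
by move=> cd0 ab0; move: gen'; rewrite cd0 ab0.
Qed.

End Convergence.

(** * Comparison of f with the weighted norm *)

(* With w = 1 - |t|^2 one has |1 + t|^2 |1 - t|^2 = w^2 + 4 (Im t)^2, so
   4 f(t) = |1 - t^2|^2 / w^2 * (N - 2) + 4 where N is the norm weighted by q. *)
Lemma ff_ge_wnorm (R : realType) (a b c d t : R[i])
    (q := normsq (1 + t) / normsq (1 - t)) :
  a * d - b * c = 1 -> cabs t < 1 ->
  0 < q /\ wnorm q a b c d + 2 <= 4 * ff a b c d t.
Proof.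
move=> h t1; have w0 : 0 < 1 - normsq t.
  by rewrite subr_gt0 -cabs_sqr expr_lt1 ?cabs_ge0.
have cabs4 (z : R[i]) : cabs z ^+ 4 = normsq z ^+ 2.
  by rewrite -cabs_sqr -exprM.
rewrite /ff !cabs_sqr !cabs4.
have -> : 1 - t ^+ 2 = (1 + t) * (1 - t) by ring.
rewrite normsqM.
case: t @q t1 w0 => x y; set t := _ +i* _ => q t1 w0.
have tn : normsq t = x ^+ 2 + y ^+ 2 by [].
have n1 : normsq (1 + t) = (1 + x) ^+ 2 + y ^+ 2 by rewrite /normsq /= add0r.
have n2 : normsq (1 - t) = (1 - x) ^+ 2 + y ^+ 2.
  by rewrite /normsq /= add0r sqrrN.
have nn : normsq (1 + t) * normsq (1 - t) = (1 - normsq t) ^+ 2 + 4 * y ^+ 2.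
  by rewrite tn n1 n2; ring.
have -> : complex.Re ((t^* - t) ^+ 2) = - (4 * y ^+ 2) by rewrite /=; ring.
(* This keeps t away from 1 and -1, so that q is well defined and positive. *)
have x1 : -1 < x < 1.
  rewrite -ltr_norml -(@ltr_pXn2r _ 2) ?nnegrE // expr1n real_normK ?num_real //.
  by move: w0; rewrite tn; have := sqr_ge0 y; lra.
have p0 : 0 < normsq (1 + t).
  by rewrite n1 ltr_pwDl ?sqr_ge0 // exprn_gt0 //; lra.
have m0 : 0 < normsq (1 - t).
  by rewrite n2 ltr_pwDl ?sqr_ge0 // exprn_gt0 //; lra.
have q0 : 0 < q by rewrite divr_gt0.
split=> //; have N2 := @wnorm_ge2 _ _ q0 _ _ _ _ h.
set P := normsq (1 + t) in q n1 nn p0 q0 N2 *.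
set Q := normsq (1 - t) in q n2 nn m0 q0 N2 *.
set w := 1 - normsq t in w0 nn *.
rewrite [leRHS](_ : _ = P * Q / w ^+ 2 * (wnorm q a b c d - 2) +
    2 * (P * Q - 4 * y ^+ 2) / w ^+ 2 + 2); last first.
  by rewrite /wnorm /offdiag /q; field; rewrite !gt_eqF.
(* By [nn] the middle summand equals 2. *)
rewrite {2}nn addrK mulfK ?sqrf_eq0 ?gt_eqF //.
have : 1 * (wnorm q a b c d - 2) <= P * Q / w ^+ 2 * (wnorm q a b c d - 2).
  rewrite ler_wpM2r ?subr_ge0 // ler_pdivlMr ?exprn_gt0 // mul1r nn lerDl.
  by rewrite mulr_ge0 ?sqr_ge0.
by lra.
Qed.

(** * The degenerate cases, in which the group is elementary *)

Section Elementary.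
Variables (R : realType) (theta : R).
Implicit Types a b c d : R[i].

(** Here g is scalar and fixes every line, so an eigenline of h is fixed by the whole group. *)
Lemma scalar_rotmx_elementary a b c d : a * d - b * c = 1 -> sin theta = 0 ->
  elementary (gen2 (rotmx theta) (mx2 a b c d)).
Proof.
move=> h s0; have gE : rotmx theta = (expi theta)%:M.
  have e : expi (- theta) = expi theta :> R[i].
    by rewrite /expi cosN sinN s0 oppr0.
  by rewrite rotmxE e; apply: mx2_ext; rewrite !mxE.
have [v v0 [lam e]] := mx2_eigenvector _ (mx2 a b c d).
have u1 : rotmx theta \in unitmx by rewrite rotmxE mx2_unit // rotmx_det.
have u2 : mx2 a b c d \in unitmx by rewrite mx2_unit.
apply: (invariant_lines_elementary _ _ _ v [:: v]) => //; first by rewrite inE.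
have inv (A : 'M[R[i]]_2) mu : A \in unitmx -> A *m v = mu *: v ->
    invmx A *m v = mu^-1 *: v.
  move=> Au Av; have mu0 : mu != 0.
    apply: contraNneq v0 => mu0.
    by rewrite -(mulKmx Au v) Av mu0 scale0r mulmx0.
  by rewrite -{1}[v]scale1r -(mulVf mu0) -scalerA -Av -scalemxAr mulKmx.
have ge : rotmx theta *m v = expi theta *: v by rewrite gE mul_scalar_mx.
move=> A + w; rewrite !inE => + /eqP ->.
case/or4P => /eqP ->; exists v; rewrite ?inE //.
- by exists (expi theta).
- by exists (expi theta)^-1; apply: inv.
- by exists lam.
- by exists lam^-1; apply: inv.
Qed.

(** With determinant 1, h is diagonal or antidiagonal. All generators then permute the two
    coordinate axes, that is, the endpoints 0 and infinity of the axis of g. *)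
Lemma monomial_elementary a b c d :
  a * d - b * c = 1 -> a * b = 0 -> c * d = 0 ->
  elementary (gen2 (rotmx theta) (mx2 a b c d)).
Proof.
move=> h ab cd.
pose e1 : 'cV[R[i]]_2 := \col_i (if i == 0 then 1 else 0).
pose e2 : 'cV[R[i]]_2 := \col_i (if i == 0 then 0 else 1).
have col1 x y z u : mx2 x y z u *m e1 = \col_i (if i == 0 then x else z).
  apply/matrixP => i j; rewrite !mxE !big_ord_recr big_ord0 /= !mxE /=.
  by case: (i == 0); rewrite mulr1 mulr0 addr0 add0r.
have col2 x y z u : mx2 x y z u *m e2 = \col_i (if i == 0 then y else u).
  apply/matrixP => i j; rewrite !mxE !big_ord_recr big_ord0 /= !mxE /=.
  by case: (i == 0); rewrite mulr1 mulr0 !add0r.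
have ax1 x : \col_i (if i == 0 then x else 0) = x *: e1.
  by apply/matrixP => i j; rewrite !mxE; case: ifP; rewrite ?mulr1 ?mulr0.
have ax2 x : \col_i (if i == 0 then 0 else x) = x *: e2.
  by apply/matrixP => i j; rewrite !mxE; case: ifP; rewrite ?mulr1 ?mulr0.
have e10 : e1 != 0.
  by apply/eqP => /matrixP/(_ 0 0)/eqP; rewrite !mxE oner_eq0.
have mono (x y z u : R[i]) : x * u - y * z = 1 -> x * y = 0 -> z * u = 0 ->
    (y = 0 /\ z = 0) \/ (x = 0 /\ u = 0).
  move=> hx /eqP xy /eqP zu; move: xy zu; rewrite !mulf_eq0.
  case/orP => /eqP e; case/orP => /eqP e'; rewrite ?e ?e'; try by [left|right].
  - by move: hx => /eqP; rewrite e e' mul0r mulr0 subr0 eq_sym oner_eq0.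
  - by move: hx => /eqP; rewrite e e' mulr0 mul0r subr0 eq_sym oner_eq0.
have act (x y z u : R[i]) : x * u - y * z = 1 -> x * y = 0 -> z * u = 0 ->
    forall w, w \in [:: e1; e2] -> exists2 w', w' \in [:: e1; e2] &
    exists lam : R[i], mx2 x y z u *m w = lam *: w'.
  move=> hx xy zu w; rewrite !inE.
  have i1 : e1 \in [:: e1; e2] by rewrite inE eqxx.
  have i2 : e2 \in [:: e1; e2] by rewrite !inE eqxx orbT.
  case: (mono _ _ _ _ hx xy zu) => -[-> ->] /orP[] /eqP ->; rewrite ?col1 ?col2.
  - by exists e1 => //; exists x.
  - by exists e2 => //; exists u.
  - by exists e2 => //; exists z.
  - by exists e1 => //; exists y.
have u1 : rotmx theta \in unitmx by rewrite rotmxE mx2_unit // rotmx_det.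
apply: (invariant_lines_elementary _ _ _ e1 [:: e1; e2]) => //.
  by rewrite inE eqxx.
move=> A; rewrite !inE; case/or4P => /eqP ->; rewrite ?rotmxE.
- by apply: act; rewrite ?rotmx_det ?mulr0 ?mul0r.
- rewrite mx2_inv ?rotmx_det //.
  by apply: act; rewrite oppr0 ?mulr0 ?mul0r // subr0 mulrC expiM_N.
- exact: act.
- rewrite mx2_inv //; apply: act; first by rewrite -h; ring.
  + by case: (mono _ _ _ _ h ab cd) => -[e e']; rewrite ?e ?e' ?oppr0 ?mulr0 ?mul0r.
  + by case: (mono _ _ _ _ h ab cd) => -[e e']; rewrite ?e ?e' ?oppr0 ?mulr0 ?mul0r.
Qed.

End Elementary.

Theorem theorem1p2 (R : realType) (theta : R) (a b c d : R[i]) :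
  SL2 (mx2 a b c d) ->
  discrete_set (gen2 (rotmx theta) (mx2 a b c d)) ->
  non_elementary (gen2 (rotmx theta) (mx2 a b c d)) ->
  forall t : R[i], cabs t < 1 ->
    1 <= 4 * ff a b c d t * sin theta ^+ 2.
Proof.
rewrite /SL2 det_mx2E => h disc nelem t t1.
have s0 : sin theta != 0.
  by apply/eqP => s0; apply: nelem; apply: scalar_rotmx_elementary.
have gen : (a * b != 0) || (c * d != 0).
  rewrite -negb_and; apply/andP => -[/eqP ab /eqP cd].
  by apply: nelem; apply: monomial_elementary.
(* The lower bound holds for every q > 0; t selects the value of q. *)
have [q0 le] := ff_ge_wnorm _ _ _ _ _ _ h t1.
apply: le_trans (discrete_generic_wnorm _ _ _ _ _ _ _ q0 s0 h gen disc) _.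
by rewrite mulrC ler_wpM2r ?sqr_ge0.
Qed.
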